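(* Let $G$ be a connected finite simple graph with $n\ge 2$ vertices and $m$ edges. Then $$s_Q(G)\ \ge\ \frac{2}{n}\sqrt{n\,M_1(G)-4m^2+2mn}.$$
   Context: For a finite simple graph $G$ on $n$ vertices with vertex degrees $d_1,\ldots,d_n$, let $A_G$ be its adjacency matrix and $D_G$ the diagonal matrix of vertex degrees. The signless Laplacian matrix is $Q_G=D_G+A_G$ with eigenvalues $q_1\ge q_2\ge\cdots\ge q_n$, and the signless Laplacian spread is $s_Q(G)=q_1-q_n$. The first Zagreb index is $M_1(G)=\sum_{i=1}^n d_i^2$. *)

(* Defs.v *)
From mathcomp Require Import all_boot all_order all_algebra.
From mathcomp Require Import polyrcf complex.

Set Implicit Arguments.
Unset Strict Implicit.
Unset Printing Implicit Defensive.

Import Order.TTheory GRing.Theory Num.Theory.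

Local Open Scope ring_scope.

Record sgraph (n : nat) := SGraph {
  adj :> rel 'I_n;
  adj_sym : symmetric adj;
  adj_irr : irreflexive adj }.

Section Graph.
Variables (n : nat) (G : sgraph n).

Definition edges : {set {set 'I_n}} :=
  [set [set p.1; p.2] | p in [set p : 'I_n * 'I_n | adj G p.1 p.2]].

Definition connected_graph : Prop := forall x y : 'I_n, connect (adj G) x y.

Definition degree (x : 'I_n) : nat := #|[set y | adj G x y]|.

Definition first_zagreb : nat := (\sum_(x < n) degree x ^ 2)%N.

Variable R : rcfType.

Definition adjmx : 'M[R]_n := \matrix_(i, j) (adj G i j)%:R.

Definition degmx : 'M[R]_n := diag_mx (\row_j (degree j)%:R).

Definition signless_laplacian : 'M[R]_n := degmx + adjmx.

End Graph.

(* The eigenvalues lying in R, each repeated according to its multiplicity as a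
   root of the characteristic polynomial, in nonincreasing order.  By
   [eigenvalues_symmetric] these are all n eigenvalues if A is symmetric. *)
Definition eigenvalues (R : rcfType) (n : nat) (A : 'M[R]_n) : seq R :=
  sort >=%R (flatten [seq nseq (mup x (char_poly A)) x
                     | x <- rootsR (char_poly A)]).

(* Indices start at 0: the largest eigenvalue is number 0, the smallest is
   number n.-1. *)
Definition signless_eigenvalue (R : rcfType) (n : nat) (G : sgraph n)
  (i : nat) : R := (eigenvalues (signless_laplacian G R))`_i.

Definition signless_spread (R : rcfType) (n : nat) (G : sgraph n) : R :=
  signless_eigenvalue R G 0 - signless_eigenvalue R G n.-1.

Lemma signless_laplacian_sym (R : rcfType) (n : nat) (G : sgraph n) :
  (signless_laplacian G R)^T = signless_laplacian G R.
Proof.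
by rewrite /signless_laplacian linearD /= tr_diag_mx; congr (_ + _);
  apply/matrixP => i j; rewrite !mxE adj_sym.
Qed.

Lemma char_poly_conj (F : fieldType) (n : nat) (P D : 'M[F]_n) :
  P \in unitmx -> char_poly (invmx P *m D *m P) = char_poly D.
Proof.
move=> Pu; rewrite /char_poly /char_poly_mx !map_mxM /=.
have VP : map_mx polyC (invmx P) *m map_mx polyC P = 1%:M.
  by rewrite -map_mxM mulVmx // map_mx1.
have {1}-> : 'X%:M = map_mx polyC (invmx P) *m 'X%:M *m map_mx polyC P
    :> 'M[{poly F}]_n.
  by rewrite mul_mx_scalar -scalemxAl VP scalemx1.
rewrite -mulmxBl -mulmxBr !det_mulmx mulrC mulrA -det_mulmx.
by rewrite -map_mxM mulmxV // map_mx1 det1 mul1r.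
Qed.

Lemma eigenvalues_symmetric (R : rcfType) (n : nat) (A : 'M[R]_n) :
    A^T = A ->
  [/\ size (eigenvalues A) = n, sorted >=%R (eigenvalues A)
    & char_poly A = \prod_(x <- eigenvalues A) ('X - x%:P)].
Proof.
move=> symA; pose B := map_mx (real_complex R) A.
have [s def_s]: exists s : seq R, char_poly A = \prod_(x <- s) ('X - x%:P).
  have BRe : B \is a mxOver Num.real.
    by apply/mxOverP => i j; rewrite mxE; apply/complex_realP; exists (A i j).
  have Bherm : B \is hermsymmx.
    apply: realsym_hermsym => //.
    rewrite is_hermitianmxE expr0 scale1r map_mx_id //.
    by rewrite /B map_trmx symA.
  have dRe := hermitian_spectral_diag_real Bherm.
  have /orthomx_spectralP defB := hermitian_normalmx Bherm.
  set d := spectral_diag B in defB dRe.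
  exists [seq complex.Re (d 0 i) | i : 'I_n].
  apply: (map_poly_inj (real_complex R)); rewrite map_char_poly -/B defB.
  rewrite char_poly_conj ?spectral_unit // char_poly_trig ?diag_mx_is_trig //.
  rewrite big_image rmorph_prod; apply: eq_bigr => i _ /=.
  rewrite map_polyXsubC mxE eqxx mulr1n; congr ('X - _%:P).
  by apply/esym/RRe_real/(mxOverP dRe).
have p_neq0 : char_poly A != 0 := monic_neq0 (char_poly_monic A).
have perm_s : perm_eq (eigenvalues A) s.
  rewrite /eigenvalues perm_sort; apply/allP => x _ /=; apply/eqP.
  rewrite -(mu_prod_XsubC x s) -def_s count_flatten -map_comp.
  have roots_x : (x \in rootsR (char_poly A)) = root (char_poly A) x.
    by rewrite -(roots_on_rootsR p_neq0).
  transitivity (mup x (char_poly A) * (x \in rootsR (char_poly A)))%N.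
    rewrite -count_uniq_mem ?uniq_roots //.
    elim: (rootsR _) => [|y r IHr] /=; rewrite ?muln0 // IHr count_nseq /= mulnDr.
    by congr (_ + _)%N; case: eqVneq => [->|_]; rewrite ?mul1n ?muln1 ?muln0.
  rewrite roots_x; case: (boolP (root _ x)) => [_|/mupNroot->] //.
  by rewrite muln1.
have def_p : char_poly A = \prod_(x <- eigenvalues A) ('X - x%:P).
  by rewrite def_s; apply/esym/perm_big.
split=> //; last by apply: sort_sorted => x y; apply: le_total.
by apply: succn_inj; rewrite -(size_prod_XsubC _ id) -def_p size_char_poly.
Qed.

(* Main.v *)
Require Import Defs.
From mathcomp Require Import all_boot all_order all_algebra.
From mathcomp Require Import ring lra.
Import Order.TTheory GRing.Theory Num.Theory.
Local Open Scope ring_scope.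

(** The trace and the sum of the squared entries of [Q] are [2 m] and
    [M_1 + 2 m]; these are the first two power sums of the eigenvalues of [Q].
    The bound is then Popoviciu's inequality: [n] reals in an interval of length
    [s] have variance at most [s ^ 2 / 4]. *)

Lemma eq_set2_pair (T : finType) (x y a b : T) :
  [set a; b] = [set x; y] -> a != b -> ((a, b) == (x, y)) || ((a, b) == (y, x)).
Proof.
move=> /setP eq_ab; have := (eq_ab a, eq_ab b); rewrite !inE !eqxx orbT /=.
rewrite !xpair_eqE => -[/esym /orP[] /eqP-> /esym /orP[] /eqP->];
  by rewrite ?eqxx ?orbT.
Qed.

(** Double counting of the ordered adjacent pairs: grouped by first vertex they give the degrees;
    grouped by [[set p.1; p.2]] they give two per edge, [(x, y)] and [(y, x)] being distinct by
    irreflexivity. *)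
Lemma sum_degree (n : nat) (G : sgraph n) :
  (\sum_(x < n) degree G x = 2 * #|edges G|)%N.
Proof.
under eq_bigr do rewrite /degree -sum1dep_card.
rewrite pair_big_dep /= mulnC -sum_nat_const.
rewrite (eq_bigl (mem [set p | adj G p.1 p.2])) => [|p]; last by rewrite !inE.
rewrite (partition_big_imset (fun p : 'I_n * 'I_n => [set p.1; p.2])) /=.
apply: eq_bigr => _ /imsetP[[x y] + ->] /=; rewrite inE /= => Gxy.
have neq_xy : x != y by apply: contraTneq Gxy => ->; rewrite (adj_irr G).
rewrite sum1dep_card -[RHS](_ : #|[set (x, y); (y, x)]| = 2)%N.
  apply: eq_card => -[a b]; rewrite !inE /=; apply/andP/idP.
    case=> Gab /eqP/eq_set2_pair; apply.
    by apply: contraTneq Gab => ->; rewrite (adj_irr G).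
  by case/orP => /eqP[-> ->]; split; rewrite // 1?(adj_sym G) // setUC.
by rewrite cards2 xpair_eqE negb_and neq_xy.
Qed.

Lemma trace_signless_laplacian (R : rcfType) (n : nat) (G : sgraph n) :
  \tr (signless_laplacian G R) = 2 * #|edges G|%:R.
Proof.
rewrite -natrM -sum_degree natr_sum; apply: eq_bigr => i _.
by rewrite !mxE eqxx (adj_irr G) addr0.
Qed.

(** By symmetry this trace is the sum of the squared entries. In row [i] the diagonal entry gives
    the squared degree; the other entries, being 0 or 1, equal their squares and give the degree. *)
Lemma trace_signless_laplacian_sqr (R : rcfType) (n : nat) (G : sgraph n) :
  \tr (signless_laplacian G R *m signless_laplacian G R)
  = (first_zagreb G)%:R + 2 * #|edges G|%:R.
Proof.
rewrite -natrM -sum_degree /first_zagreb !natr_sum -big_split /=.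
apply: eq_bigr => i _; rewrite -{2}signless_laplacian_sym mxE.
have degE : (degree G i)%:R = \sum_j (adj G i j)%:R :> R.
  rewrite /degree -sum1dep_card natr_sum big_mkcond /=.
  by apply: eq_bigr => j _; case: (adj G i j).
rewrite degE (bigD1 i) //= [in X in _ = _ + X](bigD1 i) //= !mxE eqxx.
rewrite (adj_irr G) !addr0 add0r natrX expr2; congr (_ + _).
apply: eq_bigr => j neq_ji; rewrite !mxE eq_sym (negPf neq_ji) add0r.
by case: (adj G i j); rewrite ?mulr1 ?mulr0.
Qed.

(** For positive [n], both sides are minus the coefficient of degree [n.-1] of the characteristic
    polynomial. *)
Lemma trace_char_poly_roots (R : comNzRingType) (n : nat) (A : 'M[R]_n)
    (s : seq R) :
    size s = n -> char_poly A = \prod_(x <- s) ('X - x%:P) ->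
  \tr A = \sum_(x <- s) x.
Proof.
case: n A => [|n] A size_s def_p.
  by rewrite (size0nil size_s) big_nil /mxtrace big_ord0.
apply: oppr_inj; rewrite -char_poly_trace // def_p -size_s coefPn_prod_XsubC //.
by rewrite size_s.
Qed.

(* [det (X^2 - A^2) = det (X - A) * det (X + A)] *)
Lemma char_poly_sqr (R : idomainType) (n : nat) (A : 'M[R]_n) (s : seq R) :
    size s = n -> char_poly A = \prod_(x <- s) ('X - x%:P) ->
  char_poly (A *m A) = \prod_(x <- s) ('X - (x ^+ 2)%:P).
Proof.
move=> size_s def_p.
have size_X2 : size ('X^2 : {poly R}) = 3 by rewrite size_polyXn.
(* Polynomials may be compared after substituting ['X^2] for ['X], which turns the left side into
   the determinant of X^2 - A^2. *)
have comp_inj : injective (comp_poly ('X^2 : {poly R})).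
  move=> p q /eqP; rewrite -subr_eq0 -comp_polyB comp_poly_eq0 ?size_X2 //.
  by rewrite subr_eq0 => /eqP.
apply: comp_inj.
have compXsub (q : {poly R}) (B : 'M[R]_n) :
    map_mx (comp_poly q) (char_poly_mx B) = q%:M - map_mx polyC B.
  apply/matrixP => i j; rewrite !mxE comp_polyB comp_polyC.
  by congr (_ - _); case: (i == j); rewrite ?mulr1n ?mulr0n ?comp_polyX ?comp_poly0.
(* X + A is minus the characteristic matrix of A evaluated at -X; the factor (-1)^n of the
   determinant turns each of the n factors -X - x into X + x. *)
have plusE : \det ('X%:M + map_mx polyC A) = \prod_(x <- s) ('X + x%:P).
  have -> : 'X%:M + map_mx polyC A
      = (-1) *: map_mx (comp_poly (- 'X)) (char_poly_mx A).
    by rewrite compXsub scaleN1r opprB rmorphN /= opprK addrC.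
  rewrite detZ det_map_mx /= -/(char_poly A) def_p rmorph_prod /= -size_s.
  elim: s {size_s def_p} => [|x s IHs]; first by rewrite !big_nil mulr1.
  rewrite !big_cons -IHs comp_polyB comp_polyX comp_polyC /= exprS; ring.
rewrite /char_poly -det_map_mx compXsub map_mxM /=.
have -> : 'X^2%:M - map_mx polyC A *m map_mx polyC A
    = char_poly_mx A *m ('X%:M + map_mx polyC A).
  rewrite mulmxDr !mulmxBl -scalar_mxM -expr2 scalar_mxC.
  by rewrite addrA subrK.
rewrite det_mulmx -/(char_poly A) def_p plusE -big_split rmorph_prod /=.
apply: eq_bigr => x _; rewrite comp_polyB comp_polyX comp_polyC rmorphXn /=.
ring.
Qed.

(** The products (a - x)(x - b) are nonnegative, and their sum bounds the sum of squares by a linear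
    function of the sum. *)
Lemma popoviciu (R : realFieldType) (s : seq R) (a b : R) :
    {in s, forall x, b <= x <= a} ->
  4 * ((size s)%:R * (\sum_(x <- s) x ^+ 2) - (\sum_(x <- s) x) ^+ 2)
    <= ((size s)%:R * (a - b)) ^+ 2.
Proof.
move=> s_ab; set N := (size s)%:R; set S1 := \sum_(x <- s) x.
set S2 := \sum_(x <- s) x ^+ 2.
have sum_prod : \sum_(x <- s) (a - x) * (x - b) = (a + b) * S1 - N * (a * b) - S2.
  rewrite /S1 /S2 /N; elim: s {s_ab N S1 S2} => [|x s IHs].
    by rewrite !big_nil /=; ring.
  by rewrite !big_cons IHs /= -natr1; ring.
have : 0 <= N * ((a + b) * S1 - N * (a * b) - S2).
  rewrite mulr_ge0 ?ler0n // -sum_prod big_seq sumr_ge0 // => x /s_ab /andP[bx xa].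
  by rewrite mulr_ge0 ?subr_ge0.
(* The right side minus the left side is this square plus four times the preceding nonnegative
   quantity. *)
have := sqr_ge0 (2 * S1 - N * (a + b)).
nra.
Qed.

Lemma sorted_ge_bounds (R : realFieldType) (s : seq R) :
  sorted >=%R s -> {in s, forall x, s`_(size s).-1 <= x <= s`_0}.
Proof.
move=> sorted_s x s_x; have lt_x : (index x s < size s)%N by rewrite index_mem.
have ge_trans : transitive (>=%R : rel R) by move=> y z t zy yt; exact: le_trans yt zy.
have mono := sorted_leq_nth ge_trans (@lexx _ R) 0 sorted_s.
have s_gt0 : (0 < size s)%N := leq_ltn_trans (leq0n _) lt_x.
rewrite -[x in _ <= x <= _](nth_index 0 s_x).
by apply/andP; split; apply: mono; rewrite ?inE ?prednK // -ltnS prednK.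
Qed.

Theorem theorem20 (R : rcfType) (n m : nat) (G : sgraph n)
    (n_ge2 : (2 <= n)%N) (connG : connected_graph G)
    (card_edges : #|edges G| = m) :
  signless_spread R G >=
    2 / n%:R * Num.sqrt (n%:R * (first_zagreb G)%:R
                         - 4 * m%:R ^+ 2 + 2 * m%:R * n%:R).
Proof.
have [size_q sorted_q def_p] := eigenvalues_symmetric (signless_laplacian_sym R G).
have := sorted_ge_bounds _ _ sorted_q; rewrite size_q => q_bounds.
have n_gt0 : 0 < n%:R :> R by rewrite ltr0n ltnW.
have := trace_char_poly_roots _ _ _ _ size_q def_p.
rewrite trace_signless_laplacian card_edges => sum_q.
have := char_poly_sqr _ _ _ _ size_q def_p.
(* With the squares as the list of roots, the trace lemma applies to the square of the matrix. *)
rewrite -(big_map (fun x : R => x ^+ 2) xpredT (fun y => 'X - y%:P)).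
move/trace_char_poly_roots; rewrite size_map big_map => /(_ size_q).
rewrite trace_signless_laplacian_sqr card_edges => sum_q2.
have := popoviciu _ _ _ _ q_bounds; rewrite size_q -sum_q -sum_q2.
rewrite -/(signless_eigenvalue R G 0) -/(signless_eigenvalue R G n.-1).
rewrite -/(signless_spread R G) => var_le.
have spread_ge0 : 0 <= signless_spread R G.
  rewrite subr_ge0; have /q_bounds/andP[+ _] // :
    (eigenvalues (signless_laplacian G R))`_0 \in eigenvalues (signless_laplacian G R).
  by rewrite mem_nth // size_q ltnW.
(* Nonnegativity makes this quantity the square root of its square, so only the radicands remain to
   be compared: [var_le] divided by 4. *)
have half_ge0 : 0 <= n%:R / 2 * signless_spread R G.
  by rewrite !mulr_ge0 ?invr_ge0 // ltW.
rewrite -ler_pdivlMl ?divr_gt0 // invf_div -[leRHS]ger0_norm // -sqrtr_sqr.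
by apply: ler_wsqrtr; move: var_le; lra.
Qed.
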